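(* Let $(A,\mathrm F)$ be a complete graded module, let $\alpha$ be a Maurer–Cartan element of $\mathfrak a_{\mathcal C,A}$ encoding a complete curved $\mathcal A_\infty$-algebra structure $(m_0,m_1,m_2,\dots)$ on $A$, and let $a\in \mathrm F_1A_{-1}$. The generating operations $m_n^a$ of the complete curved $\mathcal A_\infty$-algebra $e^{-a}\cdot\alpha$ are given, for $n\ge0$, by $$m_n^a=\sum_{r_0,\dots,r_n\ge0}(-1)^{\sum_{k=0}^nkr_k}\,m_{n+r_0+\cdots+r_n}\big(a^{r_0},-,a^{r_1},-,\dots,-,a^{r_{n-1}},-,a^{r_n}\big),$$ where $a^r$ stands for $a^{\otimes r}$.
   Context: Complete graded module: graded module with a decreasing filtration $A=\mathrm F_0A\supset \mathrm F_1A\supset\cdots$ such that $A\cong\lim_kA/\mathrm F_kA$ degreewise. $\hom$ denotes filtration preserving maps; $\mathrm{end}_A(n)=\hom(A^{\otimes n},A)$, filtered by $\mathcal F_k\hom$, the maps raising the filtration by $k$. Koszul sign rule is used; $m(a,-)$ etc. denote composites of maps. $\mathcal C$ is the nonsymmetric cooperad $\mathrm{End}_{\mathbf ks}^*$ spanned in each arity $n\ge0$ by one element $\nu_n$ of degree $n-1$, with $\Delta_{(1)}(\nu_n)=\sum_{p+q+r=n}(-1)^{p(q+1)}\nu_{p+1+r}\circ_{p+1}\nu_q$ ($p,q,r\ge0$). $\mathfrak a_{\mathcal C,A}=\prod_{n\ge0}\hom(\mathcal C(n),\mathrm{end}_A(n))$ is the complete graded left-unital pre-Lie algebra (zero differential)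 with product $(f\star g)(\nu_n)=\sum_{p+q+r=n}(-1)^{p(q+1)+|g|(p+r)}f(\nu_{p+1+r})\circ_{p+1}g(\nu_q)$ and left unit $1$ given by $\nu_1\mapsto\mathrm{id}_A$, $\nu_n\mapsto0$ for $n\ne1$. A complete curved $\mathcal A_\infty$-algebra structure on $A$ is a Maurer–Cartan element, i.e. a degree $-1$ element $\alpha$ with $\alpha\star\alpha=0$; equivalently the maps $m_n:=\alpha(\nu_n):A^{\otimes n}\to A$ of degree $n-2$ satisfy $\sum_{p+q+r=n}(-1)^{pq+r}m_{p+1+r}\circ_{p+1}m_q=0$ for all $n\ge0$. The gauge group acts on Maurer–Cartan elements by $e^\lambda\cdot\alpha=(e^\lambda\star\alpha)\circledcirc e^{-\lambda}$, for $\lambda$ of degree $0$ with arity $0$ and arity $1$ components in the first layer of the filtration, where $e^\lambda=1+\sum_{n\ge1}\frac1{n!}(\cdots(\lambda\star\lambda)\cdots)\star\lambda$ is the pre-Lie exponential and $x\circledcirc(1+b)=\sum_{n\ge0}\frac1{n!}\{x;b,\dots,b\}$ is the circle product, with symmetric braces $\{x;\}=x$, $\{x;b_1\}=x\star b_1$, $\{x;b_1,\dots,b_n\}=\{\{x;b_1,\dots,b_{n-1}\};b_n\}-\sum_{i<n}\pm\{x;b_1,\dots,\{b_i;b_n\},\dots,b_{n-1}\}$ (Koszul signs, trivial for degree $0$ elements $b_i$). An element $a\in \mathrm F_1A_{-1}$ is viewed as the degree $0$ element of $\mathfrak a_{\mathcal C,A}$ with $\nu_0\mapsto a$ and $\nu_n\mapsto0$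 for $n\ge1$; then $e^{\pm a}=1\pm a$. *)

(* Defs.v *)
From mathcomp Require Import all_boot all_order all_algebra.
From mathcomp Require Import finmap.
From mathcomp Require Import boolp classical_sets fsbigop.

Set Implicit Arguments.
Unset Strict Implicit.
Unset Printing Implicit Defensive.

Import Order.TTheory GRing.Theory Num.Theory.
Local Open Scope ring_scope.

(* A graded module is the internal direct sum of its homogeneous components
   A_d, given by the projections [pr d] onto them; [A_d = {x | pr d x = x}].
   The canonical map A_d -> lim_k A_d / F_k A_d is bijective: a point of the
   limit is represented by a sequence [u] with [u k.+1 = u k] modulo F_k. *)
Record completeGradedModule (R : comUnitRingType) := CompleteGradedModule {
  cgm_mod :> lmodType R;
  pr : int -> {linear cgm_mod -> cgm_mod};
  pr_pr : forall i j x, pr i (pr j x) = if i == j then pr j x else 0;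
  pr_sum : forall x, exists2 s : seq int, uniq s & x = \sum_(i <- s) pr i x;
  Fil : nat -> set cgm_mod;
  Fil_zero : forall k, Fil k 0;
  Fil_add : forall k x y, Fil k x -> Fil k y -> Fil k (x + y);
  Fil_scale : forall k (c : R) x, Fil k x -> Fil k (c *: x);
  Fil_graded : forall k d x, Fil k x -> Fil k (pr d x);
  Fil_full : forall x, Fil 0 x;
  Fil_decr : forall k x, Fil k.+1 x -> Fil k x;
  Fil_inj : forall d x, pr d x = x -> (forall k, Fil k x) -> x = 0;
  Fil_surj : forall d (u : nat -> cgm_mod),
    (forall k, pr d (u k) = u k) ->
    (forall k, Fil k (u k.+1 - u k)) ->
    exists2 x, pr d x = x & forall k, Fil k (x - u k)
}.

Section Defs.
Context {R : comUnitRingType} {A : completeGradedModule R}.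

Definition homogeneous (d : int) : set A := fun x => pr A d x = x.

(* n-ary operations; those in end_A(n) = hom(A^{\otimes n}, A) are singled out
   by [is_hom] below. *)
Definition op (n : nat) := n.-tuple A -> A.

Definition upd n (x : n.-tuple A) (i : 'I_n) (u : A) : n.-tuple A :=
  [tuple if j == i then u else tnth x j | j < n].

Definition multilinear n (f : op n) :=
  forall (x : n.-tuple A) (i : 'I_n) (c : R) (u v : A),
    f (upd x i (c *: u + v)) = c *: f (upd x i u) + f (upd x i v).

Definition has_degree (d : int) n (f : op n) :=
  forall (e : 'I_n -> int) (x : n.-tuple A),
    (forall i, homogeneous (e i) (tnth x i)) ->
    homogeneous (d + \sum_i e i) (f x).

(* f raises the filtration by k; F_l(A^{\otimes n}) is spanned by the
   F_{e_1}A \otimes ... \otimes F_{e_n}A with e_1 + ... + e_n = l. *)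
Definition raises_fil (k n : nat) (f : op n) :=
  forall (e : 'I_n -> nat) (x : n.-tuple A),
    (forall i, Fil (e i) (tnth x i)) -> Fil (k + \sum_i e i)%N (f x).

Definition is_hom (d : int) n (f : op n) :=
  [/\ multilinear f, has_degree d f & raises_fil 0 f].

(* x |-> (-1)^{d|x|} x, extended linearly: the Koszul sign created when a map
   of degree d passes x. The sum has finite support. *)
Definition koszul (d : int) (x : A) : A :=
  \sum_(i \in [set: int]) ((-1) ^ (d * i) : R) *: pr A i x.

Record hmap := Hmap { arity : nat; degree : int; hmap_op : op arity }.

Definition idmap : hmap := @Hmap 1 0 (fun x => thead x).
Definition eltmap (d : int) (a : A) : hmap := @Hmap 0 d (fun=> a).

Definition op_app n (f : op n) (s : seq A) : A :=
  if insub s is Some t then f t else 0.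

(* (f_1 \otimes ... \otimes f_l)(s), using
   (f \otimes f')(x \otimes x') = (-1)^{|f'||x|} f(x) \otimes f'(x'). *)
Fixpoint tensor (fs : seq hmap) (s : seq A) : seq A :=
  if fs is f :: fs' then
    op_app (@hmap_op f)
        [seq koszul (\sum_(g <- fs') degree g) x | x <- take (arity f) s]
      :: tensor fs' (drop (arity f) s)
  else [::].

(* f(f_1, ..., f_l) as a map with N inputs, where N has to be the total arity
   of fs and l the arity of f. *)
Definition compose N n (f : op n) (fs : seq hmap) : op N :=
  fun x => op_app f (tensor fs x).

(* [conv] unfolds to a product, whose arguments must stay explicit. *)
Unset Implicit Arguments.

(* The product of the hom(C(n), end_A(n)): f n stands for f(\nu_n). *)
Definition conv := forall n, op n.

Definition in_conv (d : int) (f : conv) :=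
  forall n, is_hom (d + n%:Z - 1) (f n).

Definition conv_one : conv :=
  fun n x => if n == 1%N then head 0 x else 0.
Definition conv_add (f g : conv) : conv := fun n x => f n x + g n x.
Definition conv_opp (f : conv) : conv := fun n x => - f n x.
Definition conv_scale (c : R) (f : conv) : conv := fun n x => c *: f n x.
Definition conv_elt (a : A) : conv := fun n _ => if n == 0%N then a else 0.

(* f \star g, where dg is the degree of g; g(\nu_q) has degree dg + q - 1. *)
Definition star (dg : int) (f g : conv) : conv := fun n x =>
  \sum_(p < n.+1) \sum_(q < n.+1) \sum_(r < n.+1 | (p + q + r)%N == n)
    ((-1) ^ ((p * q.+1)%N%:Z + dg * (p + r)%N%:Z) : R) *:
      compose (f (p + 1 + r)%N)
        (nseq p idmap ++ @Hmap q (dg + q%:Z - 1) (g q) :: nseq r idmap) x.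

Definition maurer_cartan (alpha : conv) :=
  in_conv (-1) alpha /\ forall n x, star (-1) alpha alpha n x = 0.

(* Convergence in the product over n of the filtered modules end_A(n). *)
Definition conv_cvg (u : nat -> conv) (l : conv) :=
  forall n k : nat, exists N0 : nat, forall N : nat, (N0 <= N)%N ->
    raises_fil k (fun x => u N n x - l n x).

Definition conv_lim (u : nat -> conv) : conv :=
  if pselect (exists l, conv_cvg u l) is left h then sval (cid h)
  else fun _ _ => 0.

Definition conv_series (t : nat -> conv) : conv :=
  conv_lim (fun N n x => \sum_(i < N) t i n x).

(* {x; b_0, ..., b_{n-1}} for b_i of degree 0, so that all signs are trivial *)
Fixpoint brace (n : nat) (x : conv) (b : nat -> conv) : conv :=
  if n is n'.+1 then fun m y =>
    star 0 (brace n' x b) (b n') m y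
    - \sum_(i < n')
        brace n' x (fun j => if j == i then star 0 (b i) (b n') else b j) m y
  else x.

(* x \circledcirc y = \sum_n 1/n! {x; b, ..., b} with y = 1 + b, |b| = 0 *)
Definition circ (x y : conv) : conv :=
  let b := conv_add y (conv_opp conv_one) in
  conv_series (fun n => conv_scale (n`!%:R)^-1 (brace n x (fun=> b))).

(* (...(f \star f)...) \star f with n.+1 factors, |f| = 0 *)
Fixpoint star_pow (n : nat) (f : conv) : conv :=
  if n is n'.+1 then star 0 (star_pow n' f) f else f.

Definition conv_exp (l : conv) : conv :=
  conv_add conv_one
    (conv_series (fun n => conv_scale (n.+1`!%:R)^-1 (star_pow n l))).

(* e^l . alpha, with |alpha| = -1 *)
Definition gauge (l alpha : conv) : conv :=
  circ (star (-1) (conv_exp l) alpha) (conv_exp (conv_opp l)).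

Definition is_sum {n : nat} {I : choiceType} (t : I -> op n) (s : op n) :=
  forall k : nat, exists J0 : {fset I}, forall J : {fset I},
    (J0 `<=` J)%fset -> raises_fil k (fun x => s x - \sum_(i <- J) t i x).

(* a^{r_0}, -, a^{r_1}, -, ..., -, a^{r_n} *)
Definition insertions (a : A) {n : nat} (r : n.+1.-tuple nat) : seq hmap :=
  nseq (thead r) (eltmap (-1) a)
    ++ flatten [seq idmap :: nseq k (eltmap (-1) a) | k <- behead r].

Definition twisted_term (m : conv) (a : A) {n : nat} (r : n.+1.-tuple nat) : op n :=
  fun x => ((-1) ^+ (\sum_(k < n.+1) k * tnth r k)%N : R) *:
    compose (m (n + \sum_(k < n.+1) tnth r k)%N) (insertions a r) x.

End Defs.

Arguments conv {R} A.

(* Main.v *)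
Require Import Defs.
From mathcomp Require Import all_boot all_order all_algebra.
From mathcomp Require Import finmap.
From mathcomp Require Import boolp classical_sets fsbigop.
From mathcomp Require Import zify.

Set Implicit Arguments.
Unset Strict Implicit.
Unset Printing Implicit Defensive.

Import GRing.Theory.
Local Open Scope ring_scope.

(** Since [a] sits in arity 0, every product [a * f] vanishes. Hence the
exponentials of [-a] and [a] are [1 - a] and [1 + a], the product
[(1 - a) * alpha] is [alpha], and the gauge action reduces to the series
[\sum_N 1/N! {alpha; a, ..., a}]. For the same reason all correction terms in
the braces vanish, and the N-th brace is the N-fold iterate of [f |-> f * a].

The signs disappear after one change of notation. Put
[shift x = - koszul (-1) x]. On multilinear [f], the operation [f |-> f * a]
inserts one [a] at each possible place and applies [shift] to every entry that
the new [a] has passed ([star_elt]). As [a] is fixed by [shift], the places of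
the earlier copies of [a] do not matter, and inserting one [a] at all places of
all the words with N copies of [a] produces each word with N+1 copies exactly
N+1 times ([graft_insert]). So the N-th brace is N! times the sum over the
compositions [r] of N of [alpha] evaluated on the word with [r_0, r_1, ...]
copies of [a] between the arguments ([brace_elt]). An argument followed by [c]
copies of [a] has been shifted [c] times, which amounts to the Koszul sign and
a factor [(-1) ^ c]; these factors multiply to the sign [(-1) ^ (\sum k r_k)]
of the proposition ([twisted_termE]).

It remains to pass to the limit. A term with N copies of [a] raises the
filtration by N, so tails are small ([raises_word]). The limit exists although
completeness is only available degree by degree: on fixed arguments all partial
sums live in one and the same finite set of degrees
([has_shifted_degree_support], [series_limit]). *)

(** * Koszul signs, degrees and filtration *)

Section Koszul.
Context {R : comUnitRingType} {A : completeGradedModule R}.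

(** Reduces identities about [koszul], an infinite sum with finite support, to one
degree at a time. *)
Lemma pr_ext (x y : A) : (forall j, pr A j x = pr A j y) -> x = y.
Proof.
move=> exy; apply/eqP; rewrite -subr_eq0; apply/eqP.
have [s _ ->] := pr_sum (x - y).
by rewrite big1 // => i _; rewrite linearB /= exy subrr.
Qed.

Lemma pr_koszul j d (x : A) : pr A j (koszul d x) = (-1) ^ (d * j) *: pr A j x.
Proof.
rewrite /koszul; have [s us xs] := pr_sum x.
have pr0 i : i \notin s -> pr A i x = 0.
  move=> nis; rewrite xs linear_sum big_seq big1 // => k ks /=.
  by rewrite pr_pr; case: eqP nis => // ->; rewrite ks.
rewrite (fsbigE s) //; last first.
  by move=> i _ nis; rewrite pr0 ?scaler0.
under eq_bigl do rewrite in_setT.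
rewrite linear_sum /=.
have [js|njs] := boolP (j \in s); last first.
  rewrite pr0 // scaler0 big1 // => i _.
  rewrite linearZ /= pr_pr; case: eqP => [<-|_]; last by rewrite scaler0.
  by rewrite pr0 // scaler0.
rewrite (bigD1_seq j) //= linearZ /= pr_pr eqxx big1 ?addr0 // => i ij.
by rewrite linearZ /= pr_pr eq_sym (negPf ij) scaler0.
Qed.

Lemma koszul_is_linear d c (x y : A) :
  koszul d (c *: x + y) = c *: koszul d x + koszul d y.
Proof.
apply: pr_ext => j; rewrite linearP !pr_koszul linearP /= scalerDr !scalerA.
by rewrite mulrC.
Qed.

Lemma koszul0 (x : A) : koszul 0 x = x.
Proof. by apply: pr_ext => j; rewrite pr_koszul mul0r expr0z scale1r. Qed.

Lemma koszulD d e (x : A) : koszul (d + e) x = koszul d (koszul e x).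
Proof.
apply: pr_ext => j; by rewrite !pr_koszul scalerA mulrDl exprzDr ?unitrN1.
Qed.

Lemma koszul_homogeneous d e (x : A) :
  homogeneous e x -> koszul d x = (-1) ^ (d * e) *: x.
Proof.
move=> hx; apply: pr_ext => j; rewrite pr_koszul linearZ /= -hx pr_pr.
by case: eqP => [->|]; rewrite ?scaler0.
Qed.

Lemma homogeneousD d (x y : A) :
  homogeneous d x -> homogeneous d y -> homogeneous d (x + y).
Proof. by rewrite /homogeneous linearD => /= -> ->. Qed.

Lemma homogeneousZ d c (x : A) : homogeneous d x -> homogeneous d (c *: x).
Proof. by rewrite /homogeneous linearZ => /= ->. Qed.

Lemma homogeneous_sum d (I : Type) (s : seq I) (F : I -> A) :
  (forall i, homogeneous d (F i)) -> homogeneous d (\sum_(i <- s) F i).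
Proof.
move=> hF; elim/big_rec: _ => [|i x _ hx]; last exact: homogeneousD.
by rewrite /homogeneous linear0.
Qed.

Lemma FilN k (x : A) : Fil k x -> Fil k (- x).
Proof. by rewrite -scaleN1r; exact: Fil_scale. Qed.

Lemma FilB k (x y : A) : Fil k x -> Fil k y -> Fil k (x - y).
Proof. by move=> hx /FilN; exact: Fil_add. Qed.

Lemma Fil_sum k (I : eqType) (s : seq I) (F : I -> A) :
  (forall i, i \in s -> Fil k (F i)) -> Fil k (\sum_(i <- s) F i).
Proof.
move=> hF; rewrite big_seq; elim/big_rec: _ => [|i x /hF]; first exact: Fil_zero.
exact: Fil_add.
Qed.

Lemma Fil_leq k l (x : A) : (k <= l)%N -> Fil l x -> Fil k x.
Proof.
by elim: l => [|l IHl]; [case: k | case: ltngtP => // [kl _ /Fil_decr /IHl|->]]; auto.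
Qed.

Lemma Fil_koszul k d (x : A) : Fil k x -> Fil k (koszul d x).
Proof.
move=> hx; have [s _ ->] := pr_sum (koszul d x).
apply: Fil_sum => i _; rewrite pr_koszul.
by apply: Fil_scale; apply: Fil_graded.
Qed.

(** Completeness gives separatedness for homogeneous elements only; the filtration
is compatible with the projections, so it extends to all elements. *)
Lemma Fil_separated (x : A) : (forall k, Fil k x) -> x = 0.
Proof.
move=> hx; apply: pr_ext => j; rewrite linear0.
apply: (@Fil_inj _ _ j) => [|k]; last exact: Fil_graded.
by rewrite pr_pr eqxx.
Qed.

(** The effect on an argument of an element of degree -1 moving past it: the
Koszul sign, times the sign [(-1) ^ p] that [star] attaches to the position [p]
of the inner operation, shared out among the [p] arguments in front of it. *)
Definition shift (x : A) := - koszul (-1) x.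

Lemma shift_is_linear c (x y : A) : shift (c *: x + y) = c *: shift x + shift y.
Proof. by rewrite /shift koszul_is_linear opprD scalerN. Qed.

Lemma iter_shift_is_linear m c (x y : A) :
  iter m shift (c *: x + y) = c *: iter m shift x + iter m shift y.
Proof. by elim: m => //= m ->; rewrite shift_is_linear. Qed.

Lemma iter_shift m (x : A) :
  iter m shift x = (-1) ^+ m *: koszul (- m%:Z) x.
Proof.
elim: m => [|m IHm] /=; first by rewrite koszul0 scale1r.
rewrite IHm /shift -[X in koszul _ X]addr0 koszul_is_linear.
have -> : koszul (-1) 0 = 0 :> A.
  by apply: pr_ext => j; rewrite pr_koszul linear0 scaler0.
rewrite addr0 -koszulD exprS mulN1r scaleNr; congr (- (_ *: koszul _ x)).
by rewrite intS opprD.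
Qed.

Lemma homogeneous_iter_shift m d (x : A) :
  homogeneous d x -> homogeneous d (iter m shift x).
Proof.
move=> hx; rewrite iter_shift (koszul_homogeneous _ hx).
by do 2!apply: homogeneousZ.
Qed.

Lemma Fil_iter_shift m k (x : A) : Fil k x -> Fil k (iter m shift x).
Proof. by rewrite iter_shift => hx; apply/Fil_scale/Fil_koszul. Qed.

(** The two signs cancel in degree -1: a new copy of [a] moves past the earlier
ones freely. *)
Lemma shift_fixed (a : A) : homogeneous (-1) a -> shift a = a.
Proof.
move=> ha; rewrite /shift (koszul_homogeneous _ ha) mulrNN mulr1 expr1z.
by rewrite scaleN1r opprK.
Qed.

End Koszul.

(** * Inserting copies of an element into a list of arguments *)

Section Words.
Context {R : comUnitRingType} {A : completeGradedModule R}.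
Implicit Types (F G : seq A -> A) (xs : seq A).

(** Operations of all arities are handled together as one function on lists. This
allows the first argument to be absorbed into the operation, as in
[fun w => F (x :: w)], the step of all inductions on the list of arguments. *)
Definition linear_in_each F := forall u v c (y z : A),
  F (u ++ (c *: y + z) :: v) = c *: F (u ++ y :: v) + F (u ++ z :: v).

Lemma linear_in_each_cons F (x : A) :
  linear_in_each F -> linear_in_each (fun w => F (x :: w)).
Proof. by move=> lF u v c y z; exact: (lF (x :: u)). Qed.

Lemma linear_in_each_cat F (w : seq A) :
  linear_in_each F -> linear_in_each (fun w' => F (w ++ w')).
Proof. by move=> lF u v c y z; rewrite !catA lF. Qed.

Lemma linear_in_each0 F u v : linear_in_each F -> F (u ++ 0 :: v) = 0.
Proof.
move=> lF; have := lF u v (-1) 0 0.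
by rewrite scaler0 addr0 scaleN1r addNr.
Qed.

Lemma linear_in_eachZ F u v c (y : A) :
  linear_in_each F -> F (u ++ (c *: y) :: v) = c *: F (u ++ y :: v).
Proof. by move=> lF; rewrite -[c *: y]addr0 lF linear_in_each0 // addr0. Qed.

(** Degrees after suspension: an argument of degree [e] counts for [e + 1], so that
the operations of a curved A-infinity structure have the same degree in all
arities and the insertion of an element of degree -1 is free of cost. *)
Definition has_shifted_degree (d : int) F := forall l : seq (int * A),
  (forall p, p \in l -> homogeneous p.1 p.2) ->
  homogeneous (d + \sum_(p <- l) (p.1 + 1)) (F (map snd l)).

Lemma has_shifted_degree_cons d e F (x : A) : homogeneous e x ->
  has_shifted_degree d F ->
  has_shifted_degree (d + (e + 1)) (fun w => F (x :: w)).
Proof.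
move=> hx hF l hl; have := hF ((e, x) :: l).
rewrite big_cons addrA; apply => p; rewrite inE => /predU1P[->//|]; exact: hl.
Qed.

Definition raises (k : nat) F := forall l : seq (nat * A),
  (forall p, p \in l -> Fil p.1 p.2) ->
  Fil (k + \sum_(p <- l) p.1) (F (map snd l)).

Lemma raises_cons k e F (x : A) : Fil e x ->
  raises k F -> raises (k + e) (fun w => F (x :: w)).
Proof.
move=> hx hF l hl; have := hF ((e, x) :: l).
rewrite big_cons addnA; apply => p; rewrite inE => /predU1P[->//|]; exact: hl.
Qed.

Context (a : A) (ha : homogeneous (-1) a).

(** The list [(a^r_0, -, a^r_1, ..., -, a^r_n)] of the proposition with all its
signs built in: the copies of [a] come from the left, so an argument is shifted
once for every copy behind it. *)
Fixpoint word (r : seq nat) xs : seq A :=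
  if r is j :: r' then
    nseq j a ++ if xs is x :: xs' then iter (sumn r') shift x :: word r' xs'
                else [::]
  else xs.

Lemma linear_in_each_word r F :
  linear_in_each F -> linear_in_each (fun w => F (word r w)).
Proof.
elim: r F => [|j r IHr] F lF //= u v c y z.
have := linear_in_each_cat (nseq j a) lF.
set G := fun w => F (_ ++ w) => lG; case: u => [|x u] /=.
  by rewrite iter_shift_is_linear; exact: (lG [::]).
exact: (IHr _ (linear_in_each_cons (iter (sumn r) shift x) lG)).
Qed.

Lemma has_shifted_degree_word d r F :
  has_shifted_degree d F -> has_shifted_degree d (fun w => F (word r w)).
Proof.
elim: r d F => [|j r IHr] d F hF //= l hl.
have: has_shifted_degree d (fun w => F (nseq j a ++ w)).
  elim: j F hF {IHr hl} => //= j IHj F hF; apply: (IHj (fun w => F (a :: w))).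
  by have := has_shifted_degree_cons ha hF; rewrite addNr addr0.
set G := fun w => F (_ ++ w) => hG; case: l hl => [|[e x] l] hl /=.
  exact: (hG [::]).
rewrite big_cons addrA.
apply: (IHr _ (fun w => G (_ :: w))).
  apply: has_shifted_degree_cons hG; apply: homogeneous_iter_shift.
  by apply: (hl (e, x)); rewrite mem_head.
by move=> p pl; apply: hl; rewrite inE pl orbT.
Qed.

Context (haF : Fil 1 a).

Lemma raises_word k r F l : raises k F -> size r = (size l).+1 ->
  (forall p, p \in l -> Fil p.1 p.2) ->
  Fil (k + sumn r + \sum_(p <- l) p.1)%N (F (word r (map snd l))).
Proof.
elim: r k F l => [|j r IHr] k F l hF //= [sr] hl.
have: raises (k + j) (fun w => F (nseq j a ++ w)).
  elim: j k F hF {IHr hl} => [|j IHj] k F hF; first by rewrite addn0.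
  rewrite -addSnnS -addn1; apply: (IHj _ (fun w => F (a :: w))).
  exact: raises_cons.
set G := fun w => F (_ ++ w) => hG; case: l sr hl => [|[e x] l] sr hl /=.
  by rewrite (size0nil sr) addn0; exact: (hG [::]).
rewrite big_cons /= addnA.
have -> : (k + (j + sumn r) + e = k + j + e + sumn r)%N by lia.
apply: (IHr _ (fun w => G (_ :: w))) => //.
- apply: raises_cons hG; apply: Fil_iter_shift.
  by apply: (hl (e, x)); rewrite mem_head.
- by move=> p pl; apply: hl; rewrite inE pl orbT.
Qed.

Fixpoint comps n N : seq (seq nat) :=
  if n is n'.+1 then
    [seq j :: r | j <- iota 0 N.+1, r <- comps n' (N - j)%N]
  else [:: [:: N]].

Lemma compsS n N :
  comps n.+1 N = [seq j :: r | j <- iota 0 N.+1, r <- comps n (N - j)%N].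
Proof. by []. Qed.

Lemma mem_comps n N r : (r \in comps n N) = (size r == n.+1) && (sumn r == N).
Proof.
elim: n N r => [|n IHn] N r.
  rewrite inE; case: r => [|j [|j' r]] //=; last by rewrite eqseq_cons andbF.
  by rewrite eqseq_cons addn0 andbT.
rewrite compsS; apply/idP/idP => [/allpairsPdep[j [r' []]]|].
  rewrite mem_iota IHn => jN /andP[/eqP sr' /eqP nr'] -> /=.
  by rewrite sr' nr' eqxx /=; lia.
case: r => [|j r] // /andP[sr /eqP jr]; apply/allpairsPdep; exists j, r.
have {}jr : (j + sumn r)%N = N := jr; split=> //.
  by rewrite mem_iota; lia.
by rewrite IHn -eqSS sr; apply/eqP; lia.
Qed.

Lemma comps_uniq n N : uniq (comps n N).
Proof.
elim: n N => // n IHn N; rewrite compsS; apply: allpairs_uniq_dep => [|//|].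
  exact: iota_uniq.
by move=> [i r] [j r'] _ _ /= [-> ->].
Qed.

Definition insert N F xs : A := \sum_(r <- comps (size xs) N) F (word r xs).

Lemma linear_in_each_insert N F : linear_in_each F -> linear_in_each (insert N F).
Proof.
move=> lF u v c y z; rewrite /insert !size_cat /= scaler_sumr -big_split /=.
by apply: eq_bigr => r _; rewrite (linear_in_each_word r lF).
Qed.

Lemma insert_nil N F : insert N F [::] = F (nseq N a).
Proof. by rewrite /insert big_seq1 /= cats0. Qed.

Lemma insert0 F xs : insert 0 F xs = F xs.
Proof.
elim: xs F => [|x xs IHxs] F; first by rewrite insert_nil.
rewrite /insert /= cats0 big_map -(IHxs (fun w => F (x :: w))) /insert !big_seq.
by apply: eq_bigr => r; rewrite mem_comps => /= /andP[_ /eqP->].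
Qed.

Lemma insert_cons N F x xs : insert N F (x :: xs) =
  \sum_(j <- iota 0 N.+1) \sum_(r <- comps (size xs) (N - j)%N)
    F (nseq j a ++ iter (sumn r) shift x :: word r xs).
Proof. by rewrite /insert -[size _]/(size xs).+1 compsS big_allpairs_dep. Qed.

(** Split according to whether the word begins with [a] or with the first argument,
which then has all [N.+1] copies of [a] behind it. *)
Lemma insertS_cons N F x xs : insert N.+1 F (x :: xs) =
  insert N (fun w => F (a :: w)) (x :: xs)
  + insert N.+1 (fun w => F (iter N.+1 shift x :: w)) xs.
Proof.
rewrite !insert_cons -[iota 0 N.+2]/(0%N :: iota 1 N.+1) big_cons addrC.
rewrite subn0 (iotaDl 1 0) big_map; congr +%R.
by rewrite [RHS]/insert !big_seq; apply: eq_bigr => r;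
  rewrite mem_comps => /andP[_ /eqP->].
Qed.

(** Insertion of one element [c] at all places, by the recursion that leaves [c]
in front or moves it past the first argument. *)
Fixpoint graft (c : A) F xs : A :=
  F (c :: xs) + if xs is x :: xs' then graft c (fun w => F (shift x :: w)) xs'
                else 0.

Lemma graft_sum c F xs : graft c F xs =
  \sum_(p < (size xs).+1) F (map shift (take p xs) ++ c :: drop p xs).
Proof.
elim: xs F => [|x xs IHxs] F; rewrite /= big_ord_recl /=.
  by rewrite big_ord0.
by rewrite IHxs.
Qed.

Lemma graftD c F G xs :
  graft c (fun w => F w + G w) xs = graft c F xs + graft c G xs.
Proof. by rewrite !graft_sum -big_split. Qed.

Lemma graftZ c b F xs : graft c (fun w => b *: F w) xs = b *: graft c F xs.
Proof. by rewrite !graft_sum scaler_sumr. Qed.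

Lemma iter_shift_a m : iter m shift a = a.
Proof. by elim: m => //= m ->; exact: shift_fixed. Qed.

(** Each word with [N.+1] copies of [a] arises by inserting any one of its copies
last, whence the factor; [shift a = a] makes all these contributions equal. Both
sides satisfy the recursion on the first letter of the word. *)
Lemma graft_insert N F xs :
  graft a (insert N F) xs = N.+1%:R *: insert N.+1 F xs.
Proof.
elim: N F xs => [|N IHN] F xs.
  rewrite scale1r -[insert 0 F](_ : F = _); last by apply/funext => w; rewrite insert0.
  elim: xs F => [|x xs IHxs] F /=; first by rewrite insert_nil addr0.
  by rewrite insertS_cons insert0 IHxs.
elim: xs F => [|x xs IHxs] F.
  rewrite /= addr0 insertS_cons.
  rewrite iter_shift_a.
  have := IHN (fun w => F (a :: w)) [::]; rewrite /= addr0 => ->.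
  by rewrite !insert_nil [in RHS]mulrS scalerDl scale1r addrC.
rewrite /= insertS_cons.
under [X in graft a X]funext => w do rewrite insertS_cons -iterSr.
rewrite graftD IHxs !addrA [X in X + _ = _]addrAC.
have := IHN (fun w => F (a :: w)) (x :: xs); rewrite /= => ->.
rewrite [insert N.+2 F _]insertS_cons scalerDr; congr +%R.
rewrite -iterS iter_shift_a.
by rewrite [in RHS]mulrS scalerDl scale1r addrC.
Qed.

Lemma graft0 F xs : linear_in_each F -> graft 0 F xs = 0.
Proof. by move=> lF; rewrite graft_sum big1 // => p _; rewrite linear_in_each0. Qed.

End Words.

(** * Operations of all arities as functions on lists *)

Section OnSeq.
Context {R : comUnitRingType} {A : completeGradedModule R}.

Definition on_seq (f : conv A) (s : seq A) : A := f (size s) (in_tuple s).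

Lemma conv_ext (f g : conv A) : (forall n x, f n x = g n x) -> f = g.
Proof. by move=> fg; apply/functional_extensionality_dep => n; apply/funext. Qed.

Lemma op_app_on_seq (f : conv A) n (s : seq A) :
  size s = n -> op_app (f n) s = on_seq f s.
Proof.
by move=> <-; rewrite /op_app (insubT (fun t => size t == size s) (eqxx (size s)));
  congr f; apply: val_inj.
Qed.

Lemma op_app_tuple n (f : op n) (x : n.-tuple A) : op_app f x = f x.
Proof. by rewrite /op_app valK. Qed.

Lemma on_seq_tuple (f : conv A) n (x : n.-tuple A) : f n x = on_seq f x.
Proof. by rewrite -op_app_tuple (op_app_on_seq f (size_tuple x)). Qed.

(** Translates the update of one coordinate of a tuple into list surgery, and so
multilinearity on tuples into [linear_in_each]. *)
Lemma val_upd n (x : n.-tuple A) (i : 'I_n) u v y w :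
  val x = u ++ y :: v -> i = size u :> nat -> val (upd x i w) = u ++ w :: v.
Proof.
move=> xE iE; have sx : n = (size (u ++ w :: v))%N.
  by rewrite -(size_tuple x) xE !size_cat.
apply: (@eq_from_nth _ w) => [|j]; rewrite size_tuple // => jn.
rewrite -[nth _ _ _](tnth_nth w (upd x i w) (Ordinal jn)) tnth_mktuple.
rewrite (tnth_nth w) xE !nth_cat -val_eqE /= iE.
by case: ltngtP => // [uj|->]; [rewrite -[(j - _)%N]prednK ?subn_gt0 | rewrite subnn].
Qed.

Lemma linear_in_each_on_seq d (f : conv A) :
  in_conv d f -> linear_in_each (on_seq f).
Proof.
move=> hf u v c y z.
set n := size (u ++ y :: v).
have un : (size u < n)%N by rewrite /n size_cat /= addnS ltnS leq_addr.
pose x := in_tuple (u ++ y :: v).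
have updE w : on_seq f (u ++ w :: v) = f n (upd x (Ordinal un) w).
  by rewrite on_seq_tuple; congr on_seq; rewrite -(@val_upd _ x (Ordinal un) u v y).
by rewrite !updE; have [-> _ _] := hf n.
Qed.

Lemma sum_fst_nth (V : nmodType) (p0 : V * A) (l : seq (V * A)) :
  \sum_(p <- l) p.1 = \sum_(i < size (map snd l)) (nth p0 l i).1.
Proof. by rewrite (big_nth p0) -(size_map snd l) big_mkord. Qed.

Lemma has_shifted_degree_on_seq d (f : conv A) :
  in_conv d f -> has_shifted_degree (d - 1) (on_seq f).
Proof.
move=> hf l hl; rewrite big_split /= (sum_fst_nth (0, 0)).
have [_ hd _] := hf (size (map snd l)).
have := hd (fun i => (nth (0, 0) l i).1) (in_tuple (map snd l)).
rewrite big_const_seq count_predT iter_addr addr0 -(size_map snd l).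
set S := \sum_(_ < _) _.
have -> : d - 1 + (S + 1 *+ size (map snd l)) = d + (size (map snd l))%:Z - 1 + S.
  by rewrite natz; lia.
apply => i; rewrite (tnth_nth 0) /= (nth_map (0, 0)) -?(size_map snd) //.
by apply/hl/mem_nth; rewrite -(size_map snd).
Qed.

Lemma raises_on_seq d (f : conv A) : in_conv d f -> raises 0 (on_seq f).
Proof.
move=> hf l hl; rewrite (sum_fst_nth (0%N, 0)).
have [_ _ hr] := hf (size (map snd l)).
apply: (hr (fun i => (nth (0%N, 0) l i).1) (in_tuple (map snd l))) => i.
rewrite (tnth_nth 0) /= (nth_map (0%N, 0)) -?(size_map snd) //.
by apply/hl/mem_nth; rewrite -(size_map snd).
Qed.

Lemma raises_fil_seq k n (F : seq A -> A) :
  (forall l : seq (nat * A), size l = n ->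
    (forall p, p \in l -> Fil p.1 p.2) ->
    Fil (k + \sum_(p <- l) p.1)%N (F (map snd l))) ->
  raises_fil k (fun x : n.-tuple A => F x).
Proof.
move=> hF e x hx; have := hF [seq (e i, tnth x i) | i <- enum 'I_n].
rewrite size_map size_enum_ord big_map big_enum /= -map_comp.
rewrite (_ : map _ _ = x); last exact: map_tnth_enum.
by apply => // _ /mapP[i _ ->]; apply: hx.
Qed.

Lemma tensor_idmap (s : seq A) q : size s = q -> tensor (nseq q idmap) s = s.
Proof.
move=> <- {q}; elim: s => //= x s IHs; rewrite take0 drop0 IHs.
rewrite (op_app_tuple (fun x => thead x) [tuple koszul _ x]) theadE.
by rewrite big_nseq iter_addr mul0rn addr0 koszul0.
Qed.

(** Only [h] has nonzero degree, so signs appear exactly on the arguments that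
precede it. *)
Lemma tensor_whisker p (h : hmap) q (s : seq A) :
  size s = (p + arity h + q)%N ->
  tensor (nseq p idmap ++ h :: nseq q idmap) s =
    map (koszul (degree h)) (take p s)
    ++ op_app (@hmap_op _ _ h) (take (arity h) (drop p s)) :: drop (p + arity h) s.
Proof.
have sum_id m : \sum_(g <- nseq m (@idmap R A)) degree g = 0.
  by rewrite big_nseq iter_addr mul0rn addr0.
elim: p s => [|p IHp] s ss /=.
  rewrite take0 drop0 tensor_idmap; last by rewrite size_drop; lia.
  congr (op_app _ _ :: _); rewrite sum_id -[RHS]map_id.
  by apply: eq_map => x; rewrite koszul0.
case: s ss => // x s [ss] /=; rewrite take0 drop0 IHp //.
rewrite (op_app_tuple (fun x => thead x) [tuple koszul _ x]) theadE.
by rewrite big_cat big_cons /= !sum_id add0r addr0.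
Qed.

Lemma size_tensor fs (s : seq A) : size (tensor fs s) = size fs.
Proof. by elim: fs s => //= f fs IHfs s; rewrite IHfs. Qed.

(** Multilinearity collects the signs of the shifted arguments into one. *)
Lemma map_shift_koszul F (u v : seq A) : linear_in_each F ->
  F (map shift u ++ v) = (-1) ^+ size u *: F (map (koszul (-1)) u ++ v).
Proof.
elim: u F => [|x u IHu] F lF /=; first by rewrite scale1r.
rewrite (IHu (fun w => F (shift x :: w))); last exact: linear_in_each_cons.
rewrite /shift -scaleN1r (linear_in_eachZ [::] _ _ _ lF) scalerA exprS mulrC //.
Qed.

Lemma op_app_eq0 n (f : op n) (s : seq A) : (forall x, f x = 0) -> op_app f s = 0.
Proof. by move=> f0; rewrite /op_app; case: insub. Qed.

(** Only the term in which the inner operation has arity 0 survives; its sign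
[(-1) ^ p] turns the Koszul signs on the first [p] arguments into shifts. *)
Lemma star_elt (f : conv A) c n (x : n.-tuple A) : linear_in_each (on_seq f) ->
  star 0 f (conv_elt c) n x = graft c (on_seq f) x.
Proof.
move=> lf; rewrite /star graft_sum size_tuple; apply: eq_bigr => p _.
rewrite (bigD1 ord0) //= [X in _ + X]big1 ?addr0 => [|q q0]; last first.
  rewrite big1 // => r /eqP pqr.
  rewrite /compose tensor_whisker /= ?size_tuple //.
  rewrite [op_app (conv_elt c q) _]op_app_eq0; last first.
    by move=> y; rewrite /conv_elt [_ == _](negPf q0).
  rewrite op_app_on_seq ?linear_in_each0 ?scaler0 //.
  by rewrite size_cat size_map size_takel /= ?size_drop size_tuple; lia.
have pn := ltn_ord p; have rn : (n - p < n.+1)%N by lia.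
rewrite (big_pred1 (Ordinal rn)) => [|r]; last first.
  by rewrite /= -val_eqE /=; lia.
rewrite mul0r addr0 muln1 /compose tensor_whisker /= ?size_tuple; last by lia.
rewrite take0 addn0 op_app_on_seq; last first.
  by rewrite size_cat size_map size_takel /= ?size_drop size_tuple; lia.
rewrite map_shift_koszul // size_takel ?size_tuple; last by lia.
by rewrite (op_app_tuple (conv_elt c 0) [tuple]).
Qed.

Lemma star_eq0 d (f g : conv A) :
  (forall n x, (0 < n)%N -> f n x = 0) -> forall n x, star d f g n x = 0.
Proof.
move=> f0 n x; rewrite /star big1 // => p _; rewrite big1 // => q _.
rewrite big1 // => r _; rewrite /compose op_app_eq0 ?scaler0 // => y.
by apply: f0; rewrite addn1.
Qed.

(** The left factor enters [star] through its components of positive arity alone,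
so [1 - a] acts as the unit. *)
Lemma star_unit d (f g : conv A) :
  (forall n x, (0 < n)%N -> f n x = conv_one n x) -> star d f g = g.
Proof.
move=> f1; apply: conv_ext => n x; rewrite /star.
have n0 : (n < n.+1)%N by [].
rewrite (bigD1 ord0) //= [X in _ + X]big1 ?addr0 => [|p p0]; last first.
  rewrite big1 // => q _; rewrite big1 // => r _.
  rewrite /compose op_app_eq0 ?scaler0 // => y; rewrite f1 ?addn1 //.
  by rewrite /conv_one ifF //; move: p0; rewrite -val_eqE /=; lia.
rewrite (bigD1 (Ordinal n0)) //= [X in _ + X]big1 ?addr0 => [|q q0]; last first.
  rewrite big1 // => r /eqP pqr.
  rewrite /compose op_app_eq0 ?scaler0 // => y; rewrite f1 ?addn1 //.
  rewrite /conv_one; case: eqP => // r0; move: q0; rewrite -val_eqE /=.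
  by move: pqr r0 => /=; lia.
rewrite (big_pred1 ord0) => [|r]; last by rewrite /= -val_eqE /=; lia.
rewrite mul0n add0r mulr0 expr0z scale1r /compose.
have := @tensor_whisker 0 (Hmap (d + n%:Z - 1) (g n)) 0 x.
rewrite /= size_tuple addn0 => ->; last by rewrite add0n.
rewrite drop0 take0 take_oversize ?drop_oversize ?size_tuple //.
by rewrite (op_app_tuple (g n) x) (op_app_tuple (f 1%N) [tuple g n x]) f1.
Qed.

End OnSeq.

(** * Limits and exponentials *)

Section Limits.
Context {R : comUnitRingType} {A : completeGradedModule R}.

Lemma raises_fil_Fil k n (f : op n) (x : n.-tuple A) : raises_fil k f -> Fil k (f x).
Proof.
move=> /(_ (fun=> 0%N) x); rewrite sum_nat_const muln0 addn0; apply => i.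
exact: Fil_full.
Qed.

(** Limits are unique because the filtration is separated, so the limit picked by
[conv_lim] can be computed. *)
Lemma conv_cvg_unique (u : nat -> conv A) (l l' : conv A) :
  conv_cvg u l -> conv_cvg u l' -> l = l'.
Proof.
move=> ul ul'; apply: conv_ext => n x; apply/eqP; rewrite -subr_eq0; apply/eqP.
apply: Fil_separated => k; have [N hN] := ul n k; have [N' hN'] := ul' n k.
have := raises_fil_Fil x (hN (maxn N N') (leq_maxl _ _)).
have := raises_fil_Fil x (hN' (maxn N N') (leq_maxr _ _)).
move=> /FilB /[apply]; rewrite (_ : _ - _ = l n x - l' n x) //.
by rewrite opprB addrC addrA subrK.
Qed.

Lemma conv_cvg_lim (u : nat -> conv A) (l : conv A) :
  conv_cvg u l -> conv_cvg u (conv_lim u).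
Proof.
move=> ul; rewrite /conv_lim; case: pselect => [h|[]]; last by exists l.
exact: (svalP (cid h)).
Qed.

Lemma conv_lim_eq (u : nat -> conv A) (l : conv A) :
  conv_cvg u l -> conv_lim u = l.
Proof. by move=> ul; apply: conv_cvg_unique (conv_cvg_lim ul) ul. Qed.

Lemma conv_series_head (t : nat -> conv A) :
  (forall i n x, t i.+1 n x = 0) -> conv_series t = t 0%N.
Proof.
move=> t0; apply: conv_lim_eq => n k; exists 1%N => -[//|N] _ e x _.
rewrite big_ord_recl [X in _ + X - _]big1 ?addr0 ?subrr; first exact: Fil_zero.
by move=> i _; exact: t0.
Qed.

(** Powers of an element of arity 0 vanish from the second on, so its exponential
series stops after the linear term. *)
Lemma star_pow_arity0 (l : conv A) : (forall n x, (0 < n)%N -> l n x = 0) ->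
  forall m n x, star_pow m.+1 l n x = 0.
Proof. by move=> l0; elim=> [|m IHm] n x; apply: star_eq0 => // *; exact: IHm. Qed.

Lemma conv_exp_arity0 (l : conv A) : (forall n x, (0 < n)%N -> l n x = 0) ->
  conv_exp l = conv_add conv_one l.
Proof.
move=> l0; rewrite /conv_exp conv_series_head => [|i n x]; last first.
  by rewrite /conv_scale star_pow_arity0 // scaler0.
by congr conv_add; apply: conv_ext => n x; rewrite /conv_scale invr1 scale1r.
Qed.

(** The finite set of degrees depends on the arguments and on the degree of the
operation, but not on the operation: this uniformity lets all the partial sums of
a series be treated with one finite set. It is obtained by expanding the
arguments, one after the other, into homogeneous components. *)
Lemma has_shifted_degree_support (xs : seq A) d : exists D : seq int,
  forall F, linear_in_each F -> has_shifted_degree d F ->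
  forall j, j \notin D -> pr A j (F xs) = 0.
Proof.
elim: xs d => [|x xs IHxs] d.
  exists [:: d] => F _ hF j; rewrite inE => jd.
  have := hF [::]; rewrite big_nil addr0 => <- //.
  by rewrite pr_pr (negPf jd).
have [s _ xE] := pr_sum x.
have [D hD] := choice (fun e => IHxs (d + (e + 1))).
exists (flatten [seq D e | e <- s]) => F lF hF j jD.
have hs e : e \in s -> pr A j (F (pr A e x :: xs)) = 0.
  move=> es; apply: (hD e (fun w => F (pr A e x :: w))).
  - exact: linear_in_each_cons.
  - by apply: has_shifted_degree_cons hF; rewrite /homogeneous pr_pr eqxx.
  - by apply: contra jD => je; apply/flattenP; exists (D e) => //; apply: map_f.
rewrite [in F _]xE; elim: s hs {xE jD} => [|e s IHs] hs.
  by rewrite big_nil (linear_in_each0 [::] _ lF) linear0.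
rewrite big_cons -[pr A e x]scale1r (lF [::]) scale1r linearD /= hs ?mem_head //.
by rewrite IHs ?addr0 // => e' e's; apply: hs; rewrite inE e's orbT.
Qed.

Lemma pr_sum_support (x : A) D : (forall j, j \notin D -> pr A j x = 0) ->
  x = \sum_(j <- undup D) pr A j x.
Proof.
move=> hD; apply: pr_ext => i; rewrite linear_sum /=.
have [iD|iD] := boolP (i \in undup D).
  rewrite (bigD1_seq i) ?undup_uniq //= pr_pr eqxx big1 ?addr0 // => j ji.
  by rewrite pr_pr eq_sym (negPf ji).
rewrite mem_undup in iD; rewrite hD // big1 // => j _; rewrite pr_pr.
by case: eqP => // <-; exact: hD.
Qed.

(** The limit is taken in each of the finitely many degrees that the partial sums
meet, and the results are added. *)
Lemma series_limit (t : nat -> seq A -> A) d (xs : seq A) :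
  (forall N, linear_in_each (t N)) -> (forall N, has_shifted_degree d (t N)) ->
  (forall N, Fil N (t N xs)) ->
  exists y, forall N, Fil N (y - \sum_(i < N) t i xs).
Proof.
move=> lt dt ft; have [D hD] := has_shifted_degree_support xs d.
pose u N := \sum_(i < N) t i xs.
have uD N j : j \notin D -> pr A j (u N) = 0.
  by move=> jD; rewrite linear_sum big1 // => i _; apply: hD.
have /choice[y hy] j : exists y, forall N, Fil N (y - pr A j (u N)).
  have [N|N|y _ hy] := @Fil_surj _ A j (fun N => pr A j (u N)).
  - by rewrite pr_pr eqxx.
  - rewrite -linearB /u big_ord_recr /= addrAC subrr add0r.
    exact: Fil_graded.
  - by exists y.
exists (\sum_(j <- undup D) y j) => N.
rewrite -/(u N) (pr_sum_support (uD N)) -sumrB; apply: Fil_sum => j _; exact: hy.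
Qed.

End Limits.

(** * Braces, twisted terms and convergence *)

Section Insertion.
Context {R : comUnitRingType} {A : completeGradedModule R}.
Context (a : A) (ha : homogeneous (-1) a).

Lemma has_shifted_degree_insert d N F : has_shifted_degree d F ->
  has_shifted_degree d (insert a N F).
Proof.
move=> hF l hl; apply: homogeneous_sum => r.
exact: (has_shifted_degree_word ha r hF).
Qed.

Lemma raises_insert (haF : Fil 1 a) k N F : raises k F -> raises (k + N) (insert a N F).
Proof.
move=> hF l hl; apply: Fil_sum => r; rewrite mem_comps size_map.
by move=> /andP[/eqP sr /eqP <-]; exact: raises_word.
Qed.

(** Pointwise limits come with an estimate in the filtration of [A] alone. To
measure how the remainder raises the filtration of its arguments, the remainder is
compared with a partial sum taken far enough, by the total filtration [S] of the
arguments. *)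
Lemma insertion_series_cvg (haF : Fil 1 a) d (F : seq A -> A) :
  linear_in_each F -> has_shifted_degree d F -> raises 0 F ->
  exists l : conv A,
    conv_cvg (fun N n x => \sum_(i < N) insert a i F x) l.
Proof.
move=> lF dF rF; pose u N xs := \sum_(i < N) insert a i F xs.
have fI N l : (forall p, p \in l -> Fil p.1 p.2) ->
    Fil (N + \sum_(p <- l) p.1)%N (insert a N F (map snd l)).
  exact: (raises_insert haF N rF).
have /choice[y hy] xs : exists y, forall N, Fil N (y - u N xs).
  apply: (@series_limit _ _ (fun N => insert a N F) d) => N.
  - exact: linear_in_each_insert.
  - exact: has_shifted_degree_insert.
  - have := fI N [seq (0%N, x) | x <- xs].
    rewrite big_map big1 // addn0 -map_comp map_id; apply=> _ /mapP[x _ ->].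
    exact: Fil_full.
exists (fun n x => y x) => n k; exists k => N kN.
apply: (raises_fil_seq (F := fun xs => u N xs - y xs)) => l _ hl.
set xs := map snd l; set S := (\sum_(p <- l) p.1)%N.
have -> : u N xs - y xs =
    - (y xs - u (N + S)%N xs) - \sum_(i < S) insert a (N + i)%N F xs.
  by rewrite opprB /u big_split_ord [RHS]addrAC addrK.
apply: FilB; first by apply/FilN/Fil_leq/hy; rewrite leq_add2r.
apply: Fil_sum => i _; apply: Fil_leq (fI _ _ hl); rewrite leq_add2r.
exact: leq_trans kN (leq_addr _ _).
Qed.

(** The correction terms of a brace replace two entries by their product, and the
product of elements of arity 0 is 0. The induction therefore has to handle braces
with entries 0 as well, and to show that they vanish: this is the second half. *)
Lemma brace_elt (alpha : conv A) : linear_in_each (on_seq alpha) ->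
  forall n (c : nat -> A), (forall j, c j = a \/ c j = 0) ->
  let B := brace n alpha (fun j => conv_elt (c j)) in
  ((forall j, (j < n)%N -> c j = a) ->
     forall m x, B m x = n`!%:R *: insert a n (on_seq alpha) x) /\
  (forall j, (j < n)%N -> c j = 0 -> forall m x, B m x = 0).
Proof.
move=> lalpha; elim=> [|n IHn] c hc /=.
  by split=> // _ m x; rewrite scale1r insert0 on_seq_tuple.
have corr m x : \sum_(i < n) brace n alpha
    (fun j => if j == i then star 0 (conv_elt (c i)) (conv_elt (c n))
              else conv_elt (c j)) m x = 0.
  rewrite big1 // => i _.
  have -> : (fun j => if j == i :> nat
                      then star 0 (conv_elt (c i)) (conv_elt (c n))
                      else conv_elt (c j))
      = (fun j => conv_elt (if j == i :> nat then 0 else c j)).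
    apply/funext => j; case: eqP => // _; apply: conv_ext => m' x'.
    rewrite star_eq0; first by rewrite /conv_elt; case: ifP.
    by move=> [|m''] // ? _.
  apply: (proj2 (IHn _ _) i) => [j||]; rewrite ?eqxx //.
  by case: eqP => // _; right.
have [IHa IH0] := IHn c hc; split=> [hca|j jn cj0] m x; rewrite corr subr0.
  have onE : on_seq (brace n alpha (fun j => conv_elt (c j))) =
             fun xs => n`!%:R *: insert a n (on_seq alpha) xs.
    by apply/funext => xs; apply: IHa => j jn; apply: hca; apply: ltnW.
  rewrite star_elt onE ?hca //; last first.
    by move=> u v b y z; rewrite linear_in_each_insert // scalerDr !scalerA mulrC.
  by rewrite graftZ graft_insert // scalerA -natrM mulnC factS.
have [jn'|nj] := ltnP j n.
  by apply: star_eq0 => m' x' _; exact: IH0 jn' cj0 _ _.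
(* The last entry is 0; the brace of the others is a multiple of an insertion sum
   or 0, hence multilinear, and so has value 0 on an argument 0. *)
have jE : j = n by lia.
have lB : linear_in_each (on_seq (brace n alpha (fun j => conv_elt (c j)))).
  have [hca|] := pselect (forall j, (j < n)%N -> c j = a).
    have -> : on_seq (brace n alpha (fun j => conv_elt (c j))) =
               fun xs => n`!%:R *: insert a n (on_seq alpha) xs.
      by apply/funext => xs; exact: IHa.
    by move=> u v b y z; rewrite linear_in_each_insert // scalerDr !scalerA mulrC.
  move=> /existsNP[i /not_implyP[i_n cia]].
  have ci0 : c i = 0 by case: (hc i).
  by move=> u v b y z; rewrite /on_seq !(IH0 i) // scaler0 addr0.
by rewrite star_elt // -jE cj0 graft0 // jE.
Qed.

(** [weight r = \sum_k k * r_k], by the recursion that matches [word]: moving from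
[r] to its tail lowers all positions by one. *)
Fixpoint weight (r : seq nat) : nat :=
  if r is _ :: r' then (sumn r' + weight r')%N else 0.

Lemma weightE r : weight r = (\sum_(k < size r) k * nth 0 r k)%N.
Proof.
elim: r => [|j r IHr]; first by rewrite big_ord0.
rewrite big_ord_recl /= mul0n add0n IHr sumnE (big_nth 0%N) big_mkord -big_split.
by apply: eq_bigr.
Qed.

(** [insertions] on lists in place of tuples, for the induction on [r]. *)
Definition insertion_hmaps (r : seq nat) : seq hmap :=
  if r is j :: r' then
    nseq j (eltmap (-1) a)
      ++ flatten [seq idmap :: nseq k (eltmap (-1) a) | k <- r']
  else [::].

Lemma size_insertion_hmaps j r :
  size (insertion_hmaps (j :: r)) = (size r + sumn (j :: r))%N.
Proof.
rewrite size_cat size_nseq /= addnCA; congr addn.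
by elim: r => //= k r; rewrite size_cat size_nseq => ->; lia.
Qed.

Lemma degree_insertion_hmaps r :
  \sum_(g <- flatten [seq idmap :: nseq k (eltmap (-1) a) | k <- r]) degree g
  = - (sumn r)%:Z.
Proof.
elim: r => [|k r IHr] /=; first by rewrite big_nil.
rewrite big_cons big_cat IHr /= big_nseq iter_addr addr0 add0r.
by rewrite mulNrn natz; lia.
Qed.

(** The Koszul sign on an argument comes from the copies of [a] behind it, and one
factor -1 of [(-1) ^+ weight r] is spent for each such pair to complete it to a
[shift]. *)
Lemma tensor_insertion_hmaps F r xs : linear_in_each F -> size r = (size xs).+1 ->
  (-1) ^+ weight r *: F (tensor (insertion_hmaps r) xs) = F (word a r xs).
Proof.
elim: r F xs => // j r IHr F xs lF [sr] /=.
have -> s fs : tensor (nseq j (eltmap (-1) a) ++ fs) s = nseq j a ++ tensor fs s.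
  elim: j {IHr} => //= j IHj; rewrite take0 drop0 IHj.
  by rewrite (op_app_tuple (fun=> a) [tuple]).
have := linear_in_each_cat (nseq j a) lF.
set G := fun w => F (_ ++ w) => lG.
case: xs sr => [|x xs] sr.
  by rewrite (size0nil sr) /= scale1r.
case: r IHr sr => // k r IHr [sr].
rewrite [flatten _]/= [tensor _ _]/= take0 drop0 /=.
rewrite (op_app_tuple (fun x => thead x) [tuple koszul _ x]) theadE.
have -> : \sum_(g <- nseq k (eltmap (-1) a) ++ flatten
    [seq idmap :: nseq k (eltmap (-1) a) | k <- r]) degree g = - (k + sumn r)%N%:Z.
  have := degree_insertion_hmaps (k :: r); rewrite /= big_cons /= add0r.
  by [].
set y := koszul _ x.
have := IHr (fun w => G (y :: w)) xs (linear_in_each_cons y lG).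
rewrite /= => IH; rewrite exprD -scalerA [X in _ *: X]IH ?sr //.
by rewrite -(linear_in_eachZ [::] _ _ _ lG) -iter_shift.
Qed.

Lemma twisted_termE (alpha : conv A) n (r : n.+1.-tuple nat) (x : n.-tuple A) :
  linear_in_each (on_seq alpha) ->
  twisted_term alpha a r x = on_seq alpha (word a r x).
Proof.
move=> lalpha; rewrite /twisted_term.
have -> : (\sum_(k < n.+1) k * tnth r k)%N = weight r.
  rewrite weightE size_tuple; apply: eq_bigr => k _.
  by rewrite (tnth_nth 0%N).
have -> : (\sum_(k < n.+1) tnth r k)%N = sumn r by rewrite sumnE big_tuple.
have rE : insertions a r = insertion_hmaps r.
  by case/tupleP: r => j r; rewrite /insertions theadE.
rewrite /compose rE op_app_on_seq; last first.
  rewrite size_tensor; case/tupleP: r {rE} => j r.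
  by rewrite size_insertion_hmaps size_tuple.
by rewrite tensor_insertion_hmaps ?size_tuple.
Qed.

End Insertion.

(** * The twisted operations *)

Theorem proposition4p7 (R : comUnitRingType)
  (hR : forall n : nat, (n.+1%:R : R) \is a GRing.unit)
  (A : completeGradedModule R)
  (alpha : conv A) (halpha : maurer_cartan alpha)
  (a : A) (haF : Fil 1 a) (hadeg : homogeneous (-1) a) (n : nat) :
  is_sum (fun r : n.+1.-tuple nat => twisted_term alpha a r)
         (gauge (conv_opp (conv_elt a)) alpha n).
Proof.
have [calpha _] := halpha; pose F := on_seq alpha.
have lF : linear_in_each F := linear_in_each_on_seq calpha.
have rF : raises 0 F := raises_on_seq calpha.
have opp0 : forall m (x : m.-tuple A), (0 < m)%N -> conv_opp (conv_elt a) m x = 0.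
  by move=> [|m] // x _; rewrite /conv_opp /conv_elt oppr0.
have oppK : conv_opp (conv_opp (conv_elt a)) = conv_elt a.
  by apply: conv_ext => m x; rewrite /conv_opp opprK.
have elt0 : forall m (x : m.-tuple A), (0 < m)%N -> conv_elt a m x = 0.
  by case.
pose u N : conv A := fun m x => \sum_(i < N) insert a i F x.
(* The product with the first exponential does nothing, and the second one leaves
   [circ] to insert [a]. *)
have gaugeE : gauge (conv_opp (conv_elt a)) alpha = conv_lim u.
  rewrite /gauge oppK !conv_exp_arity0 // star_unit; last first.
    by move=> m x m0; rewrite /conv_add opp0 // addr0.
  rewrite /circ /conv_series; congr conv_lim; apply/funext => N.
  apply: conv_ext => m x; apply: eq_bigr => i _.
  have -> : conv_add (conv_add conv_one (conv_elt a)) (conv_opp conv_one) = conv_elt a.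
    by apply: conv_ext => m' x'; rewrite /conv_add /conv_opp addrAC subrr add0r.
  have [braceE _] := @brace_elt _ _ a hadeg _ lF i (fun=> a) (fun=> or_introl erefl).
  rewrite /conv_scale braceE // scalerA mulVr ?scale1r //.
  by rewrite -(prednK (fact_gt0 i)).
have [l ul] := insertion_series_cvg hadeg haF lF (has_shifted_degree_on_seq calpha) rF.
rewrite gaugeE => k; have [N0 /(_ (maxn N0 k) (leq_maxl _ _))] := conv_cvg_lim ul n k.
set N := maxn N0 k; have kN : (k <= N)%N := leq_maxr _ _; rewrite -/u => hN.
(* The compositions of all numbers below [N] form the finite set of indices whose
   sum is the [N]-th partial sum of the series. *)
pose L : seq (seq nat) := [seq r | i <- iota 0 N, r <- comps n i].
have memL r : (r \in L) = (size r == n.+1) && (sumn r < N)%N.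
  apply/allpairsPdep/idP => [[i [s [+ + ->]]]|/andP[sr rN]].
    by rewrite mem_iota mem_comps => iN /andP[-> /eqP->].
  by exists (sumn r), r; rewrite mem_iota mem_comps sr eqxx.
have uL : uniq L.
  apply: allpairs_uniq_dep => [|i _|]; [exact: iota_uniq|exact: comps_uniq|].
  move=> p q /allpairsPdep[i [r [_ + ->]]] /allpairsPdep[j [s [_ + ->]]] /=.
  by rewrite !mem_comps => /andP[_ /eqP <-] /andP[_ /eqP <-] ->.
pose TL : seq (n.+1.-tuple nat) := pmap insub L.
have uTL : uniq TL := pmap_sub_uniq _ uL.
have memTL r : (r \in TL) = (sumn r < N)%N.
  by rewrite mem_pmap_sub memL size_tuple eqxx.
have valTL : map val TL = L.
  rewrite pmap_filter; last exact: insubK.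
  apply/all_filterP/allP => r; rewrite memL => /andP[sr _].
  by rewrite /= isSome_insub.
exists [fset r in TL]%fset => J /fsubsetP sJ e x hx.
have uE : u N n x = \sum_(r <- J | r \in TL) twisted_term alpha a r x.
  rewrite -big_filter (perm_big TL) /=; last first.
    apply: uniq_perm => // [|r]; first exact/filter_uniq/fset_uniq.
    by rewrite mem_filter andb_idr // => rT; apply: sJ; rewrite inE.
  under eq_bigr do rewrite twisted_termE //.
  rewrite -(big_map val xpredT (fun r => F (word a r x))) valTL.
  rewrite big_allpairs_dep -[N in iota 0 N]subn0 big_mkord.
  by apply: eq_bigr => i _; rewrite /insert size_tuple.
rewrite (bigID (mem TL)) /= -uE opprD addrA; apply: FilB.
  by rewrite -opprB; apply: FilN; exact: hN.
rewrite -[X in Fil _ X]big_filter.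
apply: Fil_sum => r; rewrite mem_filter memTL -leqNgt.
move=> /andP[Nr _]; rewrite twisted_termE //.
apply: (raises_fil_seq (k := k) (F := fun xs => F (word a r xs))) hx => l' sl hl.
apply: Fil_leq (raises_word haF rF _ hl); last by rewrite sl size_tuple.
by rewrite add0n leq_add2r (leq_trans kN).
Qed.
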